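(* Let $H_d^+(q_k,p_{k+1})$ be a discrete right Hamiltonian, and for a discrete curve $\{(q_k,p_k)\}_{k=0}^N$ in $T^*Q$ let $$\mathfrak{S}_d(\{(q_k,p_k)\}_{k=0}^N)=p_Nq_N-\sum_{k=0}^{N-1}\left[p_{k+1}q_{k+1}-H_d^+(q_k,p_{k+1})\right].$$ The Type II discrete Hamilton's phase space variational principle, namely that $\delta\mathfrak{S}_d(\{(q_k,p_k)\}_{k=0}^N)=0$ for discrete curves in $T^*Q$ with fixed $(q_0,p_N)$ boundary conditions (i.e., for all variations $\{(\delta q_k,\delta p_k)\}_{k=0}^N$ with $\delta q_0=0$ and $\delta p_N=0$), is equivalent to the discrete right Hamilton's equations $$q_k=D_2H_d^+(q_{k-1},p_k),\qquad p_k=D_1H_d^+(q_k,p_{k+1}),\qquad k=1,\dots,N-1.$$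
   Context: $Q$ is an $n$-dimensional configuration manifold; one works in canonical coordinates $(q,p)$ on $T^*Q$, so $Q$ may be regarded as an open subset of $\mathbb{R}^n$ and $pq=\sum_i p_iq^i$. $0=t_0<t_1<\dots<t_N=T$ is a partition of $[0,T]$, with $q_k\approx q(t_k)$, $p_k\approx p(t_k)$. A discrete right Hamiltonian is a (differentiable) real-valued function $H_d^+(q_k,p_{k+1})$ of a position and a momentum, thought of as an approximation of the Type II generating function $$\operatorname*{ext}_{\substack{(q,p)\in C^2([t_k,t_{k+1}],T^*Q)\\ q(t_k)=q_k,\ p(t_{k+1})=p_{k+1}}} p(t_{k+1})q(t_{k+1})-\int_{t_k}^{t_{k+1}}[p\dot q-H(q,p)]\,dt,$$ where $\operatorname{ext}$ denotes the stationary value and $H:T^*Q\to\mathbb{R}$ is the continuous Hamiltonian. $D_1,D_2$ denote partial derivatives with respect to the first and second arguments. *)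

(* Defs.v *)
From mathcomp Require Import all_boot all_order all_algebra.
From mathcomp Require Import all_classical all_reals all_analysis.

Set Implicit Arguments.
Unset Strict Implicit.
Unset Printing Implicit Defensive.

Import Order.TTheory GRing.Theory Num.Theory.
Import numFieldNormedType.Exports.

Local Open Scope classical_set_scope.
Local Open Scope ring_scope.

(* Canonical coordinates: Q is an open subset of R^n and T^*Q = Q x R^n.
   Momenta are covectors, written as rows of components p_i, so that the
   pairing with a position is p q = \sum_i p_i q^i. *)
Definition pairing (R : realType) (n : nat) (p q : 'rV[R]_n) : R :=
  \sum_(i < n) p 0 i * q 0 i.

(* The value of H outside Q x R^n is irrelevant. *)
Definition discrete_right_Hamiltonian (R : realType) (n : nat)
    (Q : set 'rV[R]_n) (H : 'rV[R]_n -> 'rV[R]_n -> R) : Prop :=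
  forall q p : 'rV[R]_n, Q q ->
    differentiable (fun z : 'rV[R]_n * 'rV[R]_n => H z.1 z.2) (q, p).

(* delta_mx 0 i is the i-th vector of the standard basis. *)
Definition D1 (R : realType) (n : nat) (H : 'rV[R]_n -> 'rV[R]_n -> R)
    (q p : 'rV[R]_n) : 'rV[R]_n :=
  \row_(i < n) 'D_(delta_mx 0 i) (fun x : 'rV[R]_n => H x p) q.

Definition D2 (R : realType) (n : nat) (H : 'rV[R]_n -> 'rV[R]_n -> R)
    (q p : 'rV[R]_n) : 'rV[R]_n :=
  \row_(i < n) 'D_(delta_mx 0 i) (fun y : 'rV[R]_n => H q y) p.

(* A discrete curve {(q_k, p_k)}_{k=0}^N is a pair of families indexed by
   'I_N.+1; inord k is the index k, and is only used below for k <= N. *)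
Definition discrete_action (R : realType) (n N : nat)
    (H : 'rV[R]_n -> 'rV[R]_n -> R) (q p : 'I_N.+1 -> 'rV[R]_n) : R :=
  pairing (p (inord N)) (q (inord N))
  - \sum_(0 <= k < N)
      (pairing (p (inord k.+1)) (q (inord k.+1))
       - H (q (inord k)) (p (inord k.+1))).

(* The derivative at e = 0 of the action along (q + e dq, p + e dp) exists and
   vanishes.  Since Q is open, the varied curve lies in T^*Q for small e. *)
Definition typeII_stationary (R : realType) (n N : nat)
    (H : 'rV[R]_n -> 'rV[R]_n -> R) (q p : 'I_N.+1 -> 'rV[R]_n) : Prop :=
  forall dq dp : 'I_N.+1 -> 'rV[R]_n,
    dq (inord 0) = 0 -> dp (inord N) = 0 ->
    is_derive (0 : R) (1 : R)
      (fun e : R => discrete_action H (fun k => q k + e *: dq k)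
                                      (fun k => p k + e *: dp k))
      (0 : R).

Definition discrete_right_Hamilton_eqs (R : realType) (n N : nat)
    (H : 'rV[R]_n -> 'rV[R]_n -> R) (q p : 'I_N.+1 -> 'rV[R]_n) : Prop :=
  forall k : nat, (0 < k < N)%N ->
    q (inord k) = D2 H (q (inord k.-1)) (p (inord k))
    /\ p (inord k) = D1 H (q (inord k)) (p (inord k.+1)).

(* Main.v *)
(* Once the telescoping term p_N q_N is cancelled and the sums are reindexed,
   the first variation with dq_0 = 0 and dp_N = 0 is
     \sum_(1 <= k < N) ((D1 H(q_k, p_{k+1}) - p_k) dq_k
                       + (D2 H(q_{k-1}, p_k) - q_k) dp_k),
   and the remaining dq_k, dp_k are arbitrary. *)
Require Import Defs.
From mathcomp Require Import all_boot all_order all_algebra.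
From mathcomp Require Import all_classical all_reals all_analysis.
From mathcomp Require Import ring.
Import Order.TTheory GRing.Theory Num.Theory.
Import numFieldNormedType.Exports.

Local Open Scope classical_set_scope.
Local Open Scope ring_scope.

Lemma pairingDl (R : realType) (n : nat) (p p' q : 'rV[R]_n) :
  pairing (p + p') q = pairing p q + pairing p' q.
Proof.
by rewrite /pairing -big_split; apply: eq_bigr => i _; rewrite mxE mulrDl.
Qed.

Lemma pairingZl (R : realType) (n : nat) (a : R) (p q : 'rV[R]_n) :
  pairing (a *: p) q = a * pairing p q.
Proof.
by rewrite /pairing mulr_sumr; apply: eq_bigr => i _; rewrite mxE mulrA.
Qed.

Lemma pairingC (R : realType) (n : nat) (p q : 'rV[R]_n) :
  pairing p q = pairing q p.
Proof. by apply: eq_bigr => i _; rewrite mulrC. Qed.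

Lemma pairing0r (R : realType) (n : nat) (p : 'rV[R]_n) : pairing p 0 = 0.
Proof. by rewrite /pairing big1 // => i _; rewrite mxE mulr0. Qed.

Lemma pairingBl (R : realType) (n : nat) (p p' q : 'rV[R]_n) :
  pairing (p - p') q = pairing p q - pairing p' q.
Proof. by rewrite pairingDl -scaleN1r pairingZl mulN1r. Qed.

Lemma pairing_ge0 (R : realType) (n : nat) (p : 'rV[R]_n) : 0 <= pairing p p.
Proof. by apply: sumr_ge0 => i _; rewrite -expr2 sqr_ge0. Qed.

Lemma pairing_eq0 (R : realType) (n : nat) (p : 'rV[R]_n) :
  pairing p p = 0 -> p = 0.
Proof.
move=> /eqP; rewrite psumr_eq0 => [|i _]; last by rewrite -expr2 sqr_ge0.
move=> /allP p0; apply/rowP => i; rewrite mxE.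
by have := p0 i (mem_index_enum _); rewrite mulf_eq0 orbb => /eqP.
Qed.

(** By bilinearity the pairing along a line is a quadratic polynomial in [e], and its derivative at
    0 is the linear coefficient. *)
Lemma is_derive_pairing_line (R : realType) (n : nat) (p dp q dq : 'rV[R]_n) :
  is_derive (0 : R) (1 : R) (fun e : R => pairing (p + e *: dp) (q + e *: dq))
    (pairing dp q + pairing p dq).
Proof.
set a := pairing p q; set b := pairing dp q + pairing p dq.
set c := pairing dp dq.
pose P : {poly R} := a%:P + b *: 'X + c *: 'X^2.
rewrite (_ : (fun e => _) = horner P).
  rewrite (_ : b = (deriv P).[0]); first exact: is_derive_poly.
  by rewrite /P !derivD derivC !derivZ derivX derivXn !hornerE /=; ring.
apply/funext => e; rewrite pairingDl pairingZl ![pairing _ (q + _)]pairingC.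
rewrite !pairingDl !pairingZl ![pairing q _]pairingC ![pairing dq _]pairingC.
by rewrite /P /a /b /c !hornerE /=; ring.
Qed.

(** The difference quotient at 0 of the restriction to the line is literally that of [f] at [a]
    along [v], so the directional derivative of [f] transfers. *)
Lemma is_derive_line (R : realType) (V : normedModType R) (f : V -> R)
    (a v : V) :
  differentiable f a ->
  is_derive (0 : R) (1 : R) (fun e : R => f (a + e *: v)) ('d f a v).
Proof.
move=> df; have /derivableP := @diff_derivable _ _ _ _ _ v df.
rewrite deriveE // => -[dv vE].
have E : (fun h : R => h^-1 *: (((fun e : R => f (a + e *: v)) \o shift (0 : R))
                                  (h *: (1 : R)) - f (a + (0 : R) *: v)))
         = (fun h : R => h^-1 *: ((f \o shift a) (h *: v) - f a)).
  apply/funext => h /=; rewrite scale0r !addr0 [a + _]addrC.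
  by rewrite [h *: 1]mulr1.
split; first by rewrite /derivable E.
by rewrite /derive E.
Qed.

Lemma diff_pairing (R : realType) (n : nat) (H : 'rV[R]_n -> 'rV[R]_n -> R)
    (q p dq dp : 'rV[R]_n) :
  let f := fun z : 'rV[R]_n * 'rV[R]_n => H z.1 z.2 in
  differentiable f (q, p) ->
  'd f (q, p) (dq, dp) = pairing (D1 H q p) dq + pairing (D2 H q p) dp.
Proof.
move=> f df.
(* Displacing [(q, p)] along [(delta_mx 0 i, 0)] leaves the momentum at [h *: 0 + p], so the two
   difference quotients agree; [D2E] is symmetric. *)
have D1E i : D1 H q p 0 i = 'd f (q, p) (delta_mx 0 i, 0).
  rewrite mxE -deriveE // /derive; f_equal; f_equal.
  by apply/funext => h /=; rewrite /f /= scaler0 add0r.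
have D2E i : D2 H q p 0 i = 'd f (q, p) (0, delta_mx 0 i).
  rewrite mxE -deriveE // /derive; f_equal; f_equal.
  by apply/funext => h /=; rewrite /f /= scaler0 add0r.
(* Expanding in the standard basis of the product lets linearity of the differential produce both
   pairings. *)
have -> : (dq, dp) = \sum_(i < n) dq 0 i *: (delta_mx 0 i, 0)
                   + \sum_(i < n) dp 0 i *: (0, delta_mx 0 i)
          :> 'rV[R]_n * 'rV[R]_n.
  rewrite [RHS]surjective_pairing /= !raddf_sum /=.
  rewrite [X in (_ + X, _)]big1 => [|i _]; last exact: scaler0.
  rewrite [X in (_, X + _)]big1 => [|i _]; last exact: scaler0.
  by rewrite addr0 add0r -!row_sum_delta.
rewrite linearD !linear_sum; congr (_ + _); apply: eq_bigr => i _.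
  by rewrite D1E linearZ mulrC.
by rewrite D2E linearZ mulrC.
Qed.

(** First variation for arbitrary [dq], [dp], term by term; the endpoint conditions enter only in
    [action_variation]. *)
Lemma discrete_action_is_derive (R : realType) (n N : nat)
    (Q : set 'rV[R]_n) (H : 'rV[R]_n -> 'rV[R]_n -> R)
    (q p dq dp : 'I_N.+1 -> 'rV[R]_n) :
  discrete_right_Hamiltonian Q H -> (forall k, Q (q k)) ->
  is_derive (0 : R) (1 : R)
    (fun e : R => discrete_action H (fun k => q k + e *: dq k)
                                    (fun k => p k + e *: dp k))
    (pairing (dp (inord N)) (q (inord N)) + pairing (p (inord N)) (dq (inord N))
     - \sum_(0 <= k < N)
        (pairing (dp (inord k.+1)) (q (inord k.+1))
         + pairing (p (inord k.+1)) (dq (inord k.+1))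
         - (pairing (D1 H (q (inord k)) (p (inord k.+1))) (dq (inord k))
            + pairing (D2 H (q (inord k)) (p (inord k.+1))) (dp (inord k.+1))))).
Proof.
move=> HH qQ; apply: is_deriveB; first exact: is_derive_pairing_line.
rewrite big_mkord.
(* The function with sums as values becomes a sum of functions, the form that [is_derive_sum]
   differentiates. *)
rewrite (_ : (fun e => _) = \sum_(k < N) (fun e : R =>
  pairing (p (inord k.+1) + e *: dp (inord k.+1))
          (q (inord k.+1) + e *: dq (inord k.+1))
  - H (q (inord k) + e *: dq (inord k))
      (p (inord k.+1) + e *: dp (inord k.+1)))); last first.
  by apply/funext => e; rewrite big_mkord fct_sumE.
apply: is_derive_sum => k; apply: is_deriveB.
  exact: is_derive_pairing_line.
rewrite -diff_pairing; last exact: HH.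
exact: (is_derive_line _ _ (fun z : 'rV[R]_n * 'rV[R]_n => H z.1 z.2)
  (q (inord k), p (inord k.+1)) (dq (inord k), dp (inord k.+1)) (HH _ _ (qQ _))).
Qed.

(** Discrete summation by parts: the last summand cancels the boundary term, [dq 0 = 0] removes the
    first [A] term and [dp N = 0] the last [B] term. Indexing by [nat] makes the shifts plain. *)
Lemma action_variation (R : realType) (n N : nat)
    (A B q p dq dp : nat -> 'rV[R]_n) :
  (0 < N)%N -> dq 0%N = 0 -> dp N = 0 ->
  pairing (dp N) (q N) + pairing (p N) (dq N)
     - \sum_(0 <= k < N)
        (pairing (dp k.+1) (q k.+1) + pairing (p k.+1) (dq k.+1)
         - (pairing (A k) (dq k) + pairing (B k.+1) (dp k.+1)))
  = \sum_(1 <= k < N) (pairing (A k - p k) (dq k) + pairing (B k - q k) (dp k)).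
Proof.
case: N => // N _ dq0 dpN.
rewrite sumrB [X in _ - (_ - X)]big_split /=.
have -> : \sum_(0 <= k < N.+1) pairing (A k) (dq k)
    = \sum_(1 <= k < N.+1) pairing (A k) (dq k).
  by rewrite big_ltn // dq0 pairing0r add0r.
have -> : \sum_(0 <= k < N.+1)
      (pairing (dp k.+1) (q k.+1) + pairing (p k.+1) (dq k.+1))
   = \sum_(1 <= k < N.+1) (pairing (dp k) (q k) + pairing (p k) (dq k))
     + (pairing (dp N.+1) (q N.+1) + pairing (p N.+1) (dq N.+1)).
  by rewrite big_nat_recr //= [in RHS]big_add1.
have -> : \sum_(0 <= k < N.+1) pairing (B k.+1) (dp k.+1)
   = \sum_(1 <= k < N.+1) pairing (B k) (dp k).
  by rewrite big_nat_recr //= dpN pairing0r addr0 big_add1.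
have -> : \sum_(1 <= k < N.+1)
      (pairing (A k - p k) (dq k) + pairing (B k - q k) (dp k))
  = \sum_(1 <= k < N.+1) pairing (A k) (dq k)
    + \sum_(1 <= k < N.+1) pairing (B k) (dp k)
    - \sum_(1 <= k < N.+1) (pairing (dp k) (q k) + pairing (p k) (dq k)).
  rewrite -big_split -sumrB; apply: eq_bigr => k _.
  by rewrite !pairingBl [pairing (dp k) _]pairingC /=; ring.
by ring.
Qed.

Lemma residuals_eq0 (R : realType) (n N : nat) (A B : nat -> 'rV[R]_n) :
  \sum_(1 <= k < N) (pairing (A k) (A k) + pairing (B k) (B k)) = 0 ->
  forall k, (0 < k < N)%N -> A k = 0 /\ B k = 0.
Proof.
move=> /eqP; rewrite psumr_eq0 => [/allP AB0 k kN|k _]; last first.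
  by rewrite addr_ge0 ?pairing_ge0.
have := AB0 k; rewrite mem_index_iota kN paddr_eq0 ?pairing_ge0 // => /(_ isT).
by case/andP => /eqP/pairing_eq0 -> /eqP/pairing_eq0 ->.
Qed.

Theorem lemma2 (R : realType) (n N : nat) (N_gt0 : (0 < N)%N)
    (Q : set 'rV[R]_n) (Q_open : open Q)
    (H : 'rV[R]_n -> 'rV[R]_n -> R) (H_dRH : discrete_right_Hamiltonian Q H)
    (q p : 'I_N.+1 -> 'rV[R]_n) (q_in_Q : forall k, Q (q k)) :
  typeII_stationary H q p <-> discrete_right_Hamilton_eqs H q p.
Proof.
pose A k := D1 H (q (inord k)) (p (inord k.+1)).
(* The predecessor puts both residuals at the same index [k]; [B k.+1] computes back to the [D2]
   term of the first variation. *)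
pose B k := D2 H (q (inord k.-1)) (p (inord k)).
have dS dq dp : dq (inord 0) = 0 -> dp (inord N) = 0 ->
    is_derive (0 : R) (1 : R)
      (fun e : R => discrete_action H (fun k => q k + e *: dq k)
                                      (fun k => p k + e *: dp k))
      (\sum_(1 <= k < N) (pairing (A k - p (inord k)) (dq (inord k))
                          + pairing (B k - q (inord k)) (dp (inord k)))).
  move=> dq0 dpN.
  rewrite -(action_variation _ _ N A B (q \o inord) (p \o inord)
             (dq \o inord) (dp \o inord)) //.
  exact: discrete_action_is_derive H_dRH q_in_Q.
split=> [stat k kN|HE dq dp dq0 dpN]; last first.
  apply: is_derive_eq (dS _ _ dq0 dpN) _.
  rewrite big_nat big1 // => k /HE [qE pE].
  by rewrite /A /B -qE -pE !subrr ![pairing 0 _]pairingC !pairing0r addr0.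
(* Varying along the residuals turns the variation into a sum of squares. *)
pose dq (k : 'I_N.+1) := if (0 < k < N)%N then A k - p k else 0.
pose dp (k : 'I_N.+1) := if (0 < k < N)%N then B k - q k else 0.
(* The guard [0 < k < N] makes these variations admissible, yet keeps every residual that the
   equations involve. *)
have dq0 : dq (inord 0) = 0 by rewrite /dq inordK.
have dpN : dp (inord N) = 0 by rewrite /dp inordK // ltnn andbF.
have := dS dq dp dq0 dpN; have := stat dq dp dq0 dpN.
(* The same derivative is 0 by stationarity and the residual sum by [dS], so that sum vanishes. *)
move=> /@derive_val S0 /@derive_val; rewrite S0 => /esym.
have -> : \sum_(1 <= k < N) (pairing (A k - p (inord k)) (dq (inord k))
                          + pairing (B k - q (inord k)) (dp (inord k)))
  = \sum_(1 <= k < N) (pairing (A k - p (inord k)) (A k - p (inord k))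
                    + pairing (B k - q (inord k)) (B k - q (inord k))).
  apply: eq_big_nat => j jN; have /andP[_ /ltnW jN'] := jN.
  by rewrite /dq /dp inordK // jN.
move=> /(residuals_eq0 _ _ _ (fun k => A k - p (inord k))
                             (fun k => B k - q (inord k))) /(_ k kN).
by case=> /subr0_eq AE /subr0_eq BE; split.
Qed.
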